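(* Let $\pi\colon C\to D$ be a nontrivial étale covering map between irreducible smooth projective curves over $k$. Then there is no relatively Ulrich vector bundle on $C$ with respect to $\pi$.
   Context: $k$ is an algebraically closed field of characteristic zero. ''Nontrivial'' means that $C$ is not a disjoint union of finitely many copies of $D$. For a finite morphism $\pi\colon X\to Y$ of projective varieties (integral separated schemes of finite type over $k$), a vector bundle $E$ on $X$ is relatively Ulrich with respect to $\pi$ if $\pi_*E\cong\mathcal{O}_Y^{\oplus r}$ for some positive integer $r$. *)

(* Defs.v *)
From HB Require Import structures.
From mathcomp Require Import all_boot all_algebra.
From mathcomp Require Import boolp classical_sets topology.
From mathcomp Require Import -(notations) mpoly.

Set Implicit Arguments.
Unset Strict Implicit.
Unset Printing Implicit Defensive.

Import GRing.Theory.
Local Open Scope ring_scope.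
Local Open Scope classical_set_scope.

(* Scheme-theoretic language over a field, built on the topological spaces of
   mathcomp-analysis.  Rings of sections are [comPzRingType]s, so that the zero
   ring (sections over the empty set) is allowed. *)

(** * Open sets and sheaves *)

Record opens (X : topologicalType) := Opens {
  oset :> set X;
  oset_open : open oset }.

Definition oT (X : topologicalType) : opens X := Opens (@openT X).

Definition opreim (X Y : topologicalType) (f : X -> Y) (cf : continuous f)
    (V : opens Y) : opens X :=
  Opens ((continuousP f).1 cf V (oset_open V)).

Definition is_presheaf (X : topologicalType) (F : opens X -> Type)
    (res : forall U V : opens X, V `<=` U -> F U -> F V) : Prop :=
  (forall (U : opens X) (h : U `<=` U) s, res U U h s = s) /\
  (forall (U V W : opens X) (hUV : V `<=` U) (hVW : W `<=` V) (hUW : W `<=` U) s,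
     res V W hVW (res U V hUV s) = res U W hUW s).

Definition is_sheaf (X : topologicalType) (F : opens X -> Type)
    (res : forall U V : opens X, V `<=` U -> F U -> F V) : Prop :=
  is_presheaf res /\
  forall (I : Type) (U : opens X) (V : I -> opens X)
      (hV : forall i, V i `<=` U), U `<=` \bigcup_i V i ->
    (forall s t : F U,
       (forall i, res _ _ (hV i) s = res _ _ (hV i) t) -> s = t) /\
    (forall s : forall i, F (V i),
       (forall i j (W : opens X) (hi : W `<=` V i) (hj : W `<=` V j),
          res _ _ hi (s i) = res _ _ hj (s j)) ->
       exists t : F U, forall i, res _ _ (hV i) t = s i).

Record ringed_space := RingedSpace {
  rs_pt :> topologicalType;
  sec : opens rs_pt -> comPzRingType;
  res : forall U V : opens rs_pt, V `<=` U -> {rmorphism sec U -> sec V};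
  res_sheaf : is_sheaf (fun U V h => res h : sec U -> sec V) }.

Arguments sec : clear implicits.

(** * Affine opens and schemes *)

Definition is_unit (R : comPzRingType) (a : R) : Prop := exists b, a * b = 1.

Definition prime_ideal (R : comPzRingType) (P : set R) : Prop :=
  [/\ P 0, forall a b, P a -> P b -> P (a + b), forall a b, P b -> P (a * b),
      ~ P 1 & forall a b, P (a * b) -> P a \/ P b].

(* S is the localization R_f, via phi. *)
Definition is_localization_away (R S : comPzRingType) (phi : {rmorphism R -> S})
    (f : R) : Prop :=
  [/\ is_unit (phi f),
      forall s : S, exists a n, s * phi f ^+ n = phi a
    & forall a : R, phi a = 0 -> exists n, f ^+ n * a = 0].

(* The open subspace U is isomorphic to Spec A with A = O(U): h is a
   homeomorphism from U onto the primes of A with the Zariski topology (opens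
   are the unions of the D(f)), and the structure sheaf, which is determined by
   its values on the basis of the D(f), takes on D(f) the value A_f. *)
Definition is_affine (X : ringed_space) (U : opens X) : Prop :=
  exists h : X -> set (sec X U),
  [/\ forall x, oset U x -> prime_ideal (h x),
      forall x y, oset U x -> oset U y -> h x = h y -> x = y,
      forall P, prime_ideal P -> exists2 x, oset U x & h x = P,
      forall W : set X, W `<=` U ->
        (open W <-> exists T : set (sec X U),
           forall x, oset U x -> (W x <-> exists2 f, T f & ~ h x f))
    & forall (f : sec X U) (V : opens X) (hVU : V `<=` U),
        (forall x, oset U x -> (oset V x <-> ~ h x f)) ->
        is_localization_away (res hVU) f].

Definition is_scheme (X : ringed_space) : Prop :=
  forall x : X, exists2 U : opens X, oset U x & is_affine U.

(* A morphism X -> Spec k is the same thing as a ring morphism k -> O(X). *)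
Record kscheme (k : fieldType) := KScheme {
  ks_space :> ringed_space;
  ks_const : {rmorphism k -> sec ks_space (oT ks_space)};
  ks_scheme : is_scheme ks_space }.

Definition kconst (k : fieldType) (X : kscheme k) (U : opens X) (c : k) :
  sec X U := res (@subsetT _ (U : set X) : U `<=` oT X) (ks_const X c).

(* The stalk at x of the section s is a unit. *)
Definition unit_at (X : ringed_space) (U : opens X) (s : sec X U) (x : X) :
    Prop :=
  exists (V : opens X) (hVU : V `<=` U), oset V x /\ is_unit (res hVU s).

Record kmorphism (k : fieldType) (X Y : kscheme k) := KMorphism {
  km_fun :> X -> Y;
  km_cont : continuous km_fun;
  km_pull : forall V : opens Y, {rmorphism sec Y V -> sec X (opreim km_cont V)};
  km_natural : forall (U V : opens Y) (hVU : V `<=` U)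
    (h : opreim km_cont V `<=` opreim km_cont U) (s : sec Y U),
    res h (km_pull U s) = km_pull V (res hVU s);
  (* the morphisms induced on stalks are local *)
  km_local : forall (x : X) (V : opens Y) (s : sec Y V), oset V (km_fun x) ->
    unit_at (km_pull V s) x -> unit_at s (km_fun x);
  km_const : forall (V : opens Y) (c : k),
    km_pull V (kconst V c) = kconst (opreim km_cont V) c }.

Arguments km_cont {k X Y} _ : rename.

Definition pre (k : fieldType) (X Y : kscheme k) (f : kmorphism X Y)
  (V : opens Y) : opens X := opreim (km_cont f) V.

(** * Projective space and projective varieties *)

(* Evaluation of a polynomial over k at a tuple of elements of S (the library's
   [mmap] requires S to be a nonzero ring). *)
Definition peval (k : fieldType) (S : comPzRingType) (c : k -> S) (n : nat)
    (a : 'I_n -> S) (p : mpoly n k) : S :=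
  \sum_(m <- msupp p)
     c (mcoeff m p) * \prod_(i < n) a i ^+ (fun_of_multinom m i).

(* P is P^n_k, glued from the standard charts U_i = Spec k[x_l/x_i : l != i]
   along U_i `&` U_j = D(x_j/x_i); here t i l is x_l/x_i. *)
Definition is_projective_space (k : fieldType) (n : nat) (P : kscheme k) :
    Prop :=
  exists (U : 'I_n.+1 -> opens P) (t : forall i, 'I_n.+1 -> sec P (U i)),
  [/\ forall x : P, exists i, oset (U i) x,
      forall i, is_affine (U i),
      forall i, t i i = 1 /\
        bijective (peval (kconst (U i)) (fun j : 'I_n => t i (lift i j))),
      forall i j x, oset (U i) x -> (oset (U j) x <-> unit_at (t i j) x)
    & forall i j l (V : opens P) (hi : V `<=` U i) (hj : V `<=` U j),
        res hi (t i l) = res hj (t j l) * res hi (t i j)].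

Definition closed_immersion (k : fieldType) (X Y : kscheme k)
    (f : kmorphism X Y) : Prop :=
  forall V : opens Y, is_affine V ->
    is_affine (pre f V) /\
    forall s : sec X (pre f V), exists t : sec Y V, km_pull f V t = s.

Definition projective (k : fieldType) (X : kscheme k) : Prop :=
  exists (n : nat) (P : kscheme k) (i : kmorphism X P),
    is_projective_space n P /\ closed_immersion i.

Definition integral (X : ringed_space) : Prop :=
  (exists x : X, True) /\
  forall U : opens X, U !=set0 ->
    (1 : sec X U) <> 0 /\
    forall a b : sec X U, a * b = 0 -> a = 0 \/ b = 0.

(** * Smooth curves *)

Definition irreducible_set (X : topologicalType) (Z : set X) : Prop :=
  Z !=set0 /\
  forall A B : set X, closed A -> closed B -> Z `<=` A `|` B ->
    Z `<=` A \/ Z `<=` B.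

(* Z_0 < Z_1 < ... < Z_n, irreducible closed subsets *)
Definition has_chain (X : topologicalType) (n : nat) : Prop :=
  exists Z : 'I_n.+1 -> set X,
    (forall i, closed (Z i) /\ irreducible_set (Z i)) /\
    (forall i j : 'I_n.+1, (i < j)%N -> Z i `<` Z j).

Definition krull_dim (X : topologicalType) (n : nat) : Prop :=
  has_chain X n /\ ~ has_chain X n.+1.

(* Locally X = Spec k[x_1..x_(c+d)] / (f_1..f_c), with the Jacobian determinant
   of f_1..f_c in the first c variables invertible. *)
Definition smooth (k : fieldType) (X : kscheme k) : Prop :=
  forall x : X, exists (U : opens X) (c d : nat)
      (a : 'I_(c + d) -> sec X U) (f : 'I_c -> mpoly (c + d) k),
  let ev := peval (kconst U) a in
  [/\ oset U x /\ is_affine U,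
      forall s : sec X U, exists p, ev p = s,
      forall p, ev p = 0 <->
        exists g : 'I_c -> mpoly (c + d) k, p = \sum_(i < c) g i * f i
    & is_unit (\det (\matrix_(i < c, j < c)
                       ev (mderiv (lshift d j) (f i))))].

Definition smooth_projective_curve (k : fieldType) (X : kscheme k) : Prop :=
  [/\ integral X, projective X, smooth X & krull_dim X 1].

(** * Finite and étale morphisms *)

Definition finite_morphism (k : fieldType) (X Y : kscheme k)
    (f : kmorphism X Y) : Prop :=
  forall V : opens Y, is_affine V ->
    is_affine (pre f V) /\
    exists (m : nat) (a : 'I_m -> sec X (pre f V)),
      forall s, exists b : 'I_m -> sec Y V,
        s = \sum_(i < m) km_pull f V (b i) * a i.

(* Restriction of scalars along phi. *)
Definition rscal (R S : comPzRingType) (phi : {rmorphism R -> S})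
  (M : lmodType S) : Type := M.

Section Rscal.
Variables (R S : comPzRingType) (phi : {rmorphism R -> S}) (M : lmodType S).

HB.instance Definition _ := GRing.Zmodule.on (rscal phi M).

Let scale (a : R) (m : rscal phi M) : rscal phi M := phi a *: (m : M).

Lemma rscal_scalerA a b m : scale a (scale b m) = scale (a * b) m.
Proof. by rewrite /scale scalerA rmorphM. Qed.

Lemma rscal_scale1r : left_id 1 scale.
Proof. by move=> m; rewrite /scale rmorph1 scale1r. Qed.

Lemma rscal_scalerDr : right_distributive scale +%R.
Proof. by move=> a m n; rewrite /scale scalerDr. Qed.

Lemma rscal_scalerDl m : {morph scale^~ m : a b / a + b}.
Proof. by move=> a b; rewrite /scale rmorphD scalerDl. Qed.

HB.instance Definition _ := GRing.Zmodule_isLmodule.Build R (rscal phi M)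
  rscal_scalerA rscal_scale1r rscal_scalerDr rscal_scalerDl.

Lemma rscalE (a : R) (m : rscal phi M) :
  a *: m = (phi a *: (m : M)) :> rscal phi M.
Proof. by []. Qed.

End Rscal.

Definition is_bilinear (R : comPzRingType) (M N P : lmodType R)
    (b : M -> N -> P) : Prop :=
  (forall m, linear (b m)) /\ (forall n, linear (b^~ n)).

(* The element of M (x) N which is the sum of the m (x) n for (m, n) in s is
   zero: by the universal property, all bilinear maps kill it. *)
Definition tensor_zero (R : comPzRingType) (M N : lmodType R)
    (s : seq (M * N)) : Prop :=
  forall (P : lmodType R) (b : M -> N -> P), is_bilinear b ->
    \sum_(p <- s) b p.1 p.2 = 0.

(* M (x) - preserves injections. *)
Definition flat (R : comPzRingType) (M : lmodType R) : Prop :=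
  forall (N N' : lmodType R) (u : {linear N -> N'}), injective u ->
  forall s : seq (M * N),
    tensor_zero [seq (p.1, u p.2) | p <- s] -> tensor_zero s.

(* Omega_(S/R) = 0: it represents the functor of R-derivations of S. *)
Definition zero_differentials (R S : comPzRingType)
    (phi : {rmorphism R -> S}) : Prop :=
  forall (M : lmodType S) (d : S -> M),
    (forall a b, d (a + b) = d a + d b) ->
    (forall a b, d (a * b) = a *: d b + b *: d a) ->
    (forall r, d (phi r) = 0) ->
    forall a, d a = 0.

(* Flat and unramified.  Finite presentation is not repeated: this is only used
   between schemes of finite type over k, where it is automatic. *)
Definition etale (k : fieldType) (X Y : kscheme k) (f : kmorphism X Y) : Prop :=
  forall (V : opens Y) (U : opens X) (hU : U `<=` pre f V),
    is_affine V -> is_affine U ->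
    let phi : {rmorphism sec Y V -> sec X U} := res hU \o km_pull f V in
    flat (rscal phi (sec X U)^o) /\ zero_differentials phi.

Definition etale_covering (k : fieldType) (X Y : kscheme k)
    (f : kmorphism X Y) : Prop :=
  finite_morphism f /\ etale f.

(* f restricts to an isomorphism of schemes from the open subscheme U onto Y. *)
Definition iso_on (k : fieldType) (X Y : kscheme k) (f : kmorphism X Y)
    (U : opens X) : Prop :=
  [/\ forall y, exists2 x, oset U x & f x = y,
      forall x x', oset U x -> oset U x' -> f x = f x' -> x = x',
      forall W : opens X, W `<=` U -> open (f @` W)
    & forall (V : opens Y) (W : opens X) (hW : W `<=` pre f V),
        (W : set X) = (U `&` pre f V) ->
        bijective (fun s : sec Y V => res hW (km_pull f V s))].

(* X is a disjoint union of n copies of Y, as a scheme over Y. *)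
Definition trivial_covering (k : fieldType) (X Y : kscheme k)
    (f : kmorphism X Y) : Prop :=
  exists (n : nat) (U : 'I_n -> opens X),
    [/\ forall x, exists i, oset (U i) x,
        forall i j x, oset (U i) x -> oset (U j) x -> i = j
      & forall i, iso_on f (U i)].

(** * Sheaves of modules, vector bundles, Ulrich bundles *)

Record omodule (X : ringed_space) := OModule {
  msec : forall U : opens X, lmodType (sec X U);
  mres : forall U V : opens X, V `<=` U -> msec U -> msec V;
  mresD : forall (U V : opens X) (h : V `<=` U) m n,
    mres h (m + n) = mres h m + mres h n;
  mresZ : forall (U V : opens X) (h : V `<=` U) a m,
    mres h (a *: m) = res h a *: mres h m;
  mres_sheaf : is_sheaf mres }.

Arguments msec {X} _ _.

(* M|_U and N|_U are isomorphic O_U-modules. *)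
Definition omod_iso_on (X : ringed_space) (U : opens X) (M N : omodule X) :
    Prop :=
  exists phi : forall V : opens X, V `<=` U -> {linear msec M V -> msec N V},
    (forall V h, bijective (phi V h)) /\
    (forall (V W : opens X) (hV : V `<=` U) (hW : W `<=` U) (h : W `<=` V) m,
       mres h (phi V hV m) = phi W hW (mres h m)).

Definition omod_iso (X : ringed_space) (M N : omodule X) : Prop :=
  omod_iso_on (oT X) M N.

Section FreeModule.
Variables (X : ringed_space) (r : nat).

Let fsec (U : opens X) : lmodType (sec X U) := 'rV[sec X U]_r.
Let fres (U V : opens X) (h : V `<=` U) (v : fsec U) : fsec V :=
  map_mx (res h) v.

Lemma free_resD (U V : opens X) (h : V `<=` U) m n :
  fres h (m + n) = fres h m + fres h n.
Proof. exact: map_mxD. Qed.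

Lemma free_resZ (U V : opens X) (h : V `<=` U) a m :
  fres h (a *: m) = res h a *: fres h m.
Proof. exact: map_mxZ. Qed.

Lemma free_sheaf : is_sheaf fres.
Proof.
have [[id_ comp_] sh] := res_sheaf X; split; first split.
- by move=> U h v; apply/rowP => i; rewrite mxE; apply: id_.
- by move=> U V W h1 h2 h3 v; apply/rowP => i; rewrite !mxE; apply: comp_.
move=> I U V hV cov; have [loc glue] := sh I U V hV cov; split.
  move=> s t st; apply/rowP => j; apply: loc => i.
  by have /rowP/(_ j) := st i; rewrite !mxE.
move=> s ss.
have /choice[t tP] : forall j : 'I_r, exists t : sec X U,
    forall i, res (hV i) t = s i 0 j.
  move=> j; apply: (glue (fun i => s i 0 j)) => a b W ha hb.
  by have /rowP/(_ j) := ss a b W ha hb; rewrite !mxE.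
by exists (\row_j t j) => i; apply/rowP => j; rewrite !mxE tP.
Qed.

Definition free_omodule : omodule X := OModule free_resD free_resZ free_sheaf.
End FreeModule.

Section Pushforward.
Variables (k : fieldType) (X Y : kscheme k) (f : kmorphism X Y).
Variable E : omodule X.

Lemma pre_subset (U V : opens Y) : V `<=` U -> pre f V `<=` pre f U.
Proof. by move=> h x; apply: h. Qed.

Let psec (V : opens Y) : lmodType (sec Y V) :=
  rscal (km_pull f V) (msec E (pre f V)).
Let pres (U V : opens Y) (h : V `<=` U) (m : psec U) : psec V :=
  mres (pre_subset h) (m : msec E (pre f U)).

Lemma push_resD (U V : opens Y) (h : V `<=` U) m n :
  pres h (m + n) = pres h m + pres h n.
Proof. exact: mresD. Qed.

Lemma push_resZ (U V : opens Y) (h : V `<=` U) a m :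
  pres h (a *: m) = res h a *: pres h m.
Proof. by rewrite /pres !rscalE mresZ (km_natural h). Qed.

Lemma push_sheaf : is_sheaf pres.
Proof.
have [[id_ comp_] sh] := mres_sheaf E; split; first split.
- by move=> U h m; apply: id_.
- by move=> U V W h1 h2 h3 m; apply: comp_.
move=> I U V hV cov.
have cov' : pre f U `<=` \bigcup_i pre f (V i).
  by move=> x /cov[i _ Vi]; exists i.
have [loc glue] := sh I _ _ (fun i => pre_subset (hV i)) cov'.
split; first exact: loc.
move=> s ss; apply: glue => i j W hi hj.
pose Vij : opens Y := Opens (openI (oset_open (V i)) (oset_open (V j))).
have h1 : Vij `<=` V i by move=> y [].
have h2 : Vij `<=` V j by move=> y [].
have hW : W `<=` pre f Vij by move=> x Wx; split; [exact: hi | exact: hj].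
rewrite -(comp_ _ _ _ (pre_subset h1) hW) -(comp_ _ _ _ (pre_subset h2) hW).
by congr (mres hW _); exact: (ss i j Vij h1 h2).
Qed.

Definition pushforward : omodule Y := OModule push_resD push_resZ push_sheaf.
End Pushforward.

(* Locally free of finite rank. *)
Definition vector_bundle (X : ringed_space) (E : omodule X) : Prop :=
  forall x : X, exists (U : opens X) (e : nat),
    oset U x /\ omod_iso_on U E (free_omodule X e).

Definition relatively_ulrich (k : fieldType) (X Y : kscheme k)
    (f : kmorphism X Y) (E : omodule X) : Prop :=
  vector_bundle E /\
  exists2 r : nat, (0 < r)%N & omod_iso (pushforward f E) (free_omodule Y r).

(* Main.v *)
(* Write A = O_D(V) and B = O_C(pi^-1 V) for V affine.  A trivialisation of
   pi_* E turns the action of B on E into a representation rho : B -> M_r(A),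
   natural in V.  Since B is finite and unramified over A, the ideal I of the
   diagonal in B (x)_A B satisfies I = I^2, so by Nakayama's lemma there is a
   separability idempotent sum_i x_i (x) y_i, with sum_i x_i y_i = 1 and
   sum_i b x_i (x) y_i = sum_i x_i (x) b y_i for all b.  It is unique.
   Applying rho to the second factor gives a matrix e over B with
   b e = rho(b) e.  By uniqueness the matrices e glue to a matrix over
   O_C(C) = k, so e is constant; it is nonzero, and reading b e = rho(b) e at a
   nonzero entry of e shows that b comes from A.  Hence A = B, and pi is an
   isomorphism.

   O_C(C) = k: in homogeneous coordinates, a global section f of a projective
   variety maps the finite-dimensional space of forms of degree N into itself
   for N large, so it is a root of a polynomial over k by Cayley-Hamilton. *)

Require Import Defs.
From HB Require Import structures.
From mathcomp Require Import all_boot all_algebra.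
From mathcomp Require Import boolp classical_sets topology.
From mathcomp Require Import -(notations) mpoly.

Set Implicit Arguments.
Unset Strict Implicit.
Unset Printing Implicit Defensive.

Import GRing.Theory.

(** * Separability idempotents *)

Section Algebra.
Local Open Scope ring_scope.
Local Open Scope quotient_scope.

(** * Quotients of modules by submodules *)

Section QuotientModule.
Variables (R : comPzRingType) (M : lmodType R) (J : zmodClosed M).
Hypothesis JZ : forall a m, m \in J -> a *: m \in J.

(** The [let] makes the type depend on [JZ], so that a module structure relying on that stability
    can be attached to it. *)
Definition module_quotient : Type := let _ := JZ in Quotient.quot J.
HB.instance Definition _ := GRing.Zmodule.on module_quotient.

Definition quotient_proj (m : M) : module_quotient := \pi_(Quotient.quot J) m.

Lemma quotient_proj_eq0 m : (quotient_proj m = 0) <-> (m \in J).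
Proof.
have -> : 0 = quotient_proj 0 by rewrite /quotient_proj pi_zeror.
rewrite /quotient_proj; split.
  by move=> /eqP; rewrite -Quotient.idealrBE subr0.
by move=> mJ; apply/eqP; rewrite -Quotient.idealrBE subr0.
Qed.

Lemma quotient_projB m n :
  quotient_proj (m - n) = quotient_proj m - quotient_proj n.
Proof. exact: raddfB. Qed.

Lemma quotient_projD m n :
  quotient_proj (m + n) = quotient_proj m + quotient_proj n.
Proof. exact: raddfD. Qed.

Definition quotient_scale (a : R) (x : module_quotient) : module_quotient :=
  quotient_proj (a *: repr (x : Quotient.quot J)).

Lemma quotient_scaleE a m :
  quotient_scale a (quotient_proj m) = quotient_proj (a *: m).
Proof.
apply/eqP; rewrite -subr_eq0 -quotient_projB -scalerBr; apply/eqP.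
apply/quotient_proj_eq0/JZ/quotient_proj_eq0; rewrite quotient_projB.
by apply/eqP; rewrite subr_eq0 /quotient_proj reprK.
Qed.

Lemma quotient_proj_surj x : exists m, x = quotient_proj m.
Proof.
by exists (repr (x : Quotient.quot J)); rewrite /quotient_proj reprK.
Qed.

Lemma quotient_scalerA a b x :
  quotient_scale a (quotient_scale b x) = quotient_scale (a * b) x.
Proof.
by have [m ->] := quotient_proj_surj x; rewrite !quotient_scaleE scalerA.
Qed.

Lemma quotient_scale1r : left_id 1 quotient_scale.
Proof.
by move=> x; have [m ->] := quotient_proj_surj x;
  rewrite quotient_scaleE scale1r.
Qed.

Lemma quotient_scalerDr : right_distributive quotient_scale +%R.
Proof.
move=> a x y; have [m ->] := quotient_proj_surj x.
have [n ->] := quotient_proj_surj y.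
by rewrite -quotient_projD !quotient_scaleE scalerDr quotient_projD.
Qed.

Lemma quotient_scalerDl x : {morph quotient_scale^~ x : a b / a + b}.
Proof.
move=> a b; have [m ->] := quotient_proj_surj x.
by rewrite !quotient_scaleE scalerDl quotient_projD.
Qed.

HB.instance Definition _ := GRing.Zmodule_isLmodule.Build R module_quotient
  quotient_scalerA quotient_scale1r quotient_scalerDr quotient_scalerDl.

End QuotientModule.

(** This form takes a [Prop]-valued submodule; it serves to divide M_r(B) by the square of the
    diagonal ideal. *)
Lemma exists_quotient_module (R : comPzRingType) (M : lmodType R)
    (J : M -> Prop) : J 0 -> (forall m n, J m -> J n -> J (m - n)) ->
    (forall a m, J m -> J (a *: m)) ->
  exists (Q : lmodType R) (q : M -> Q),
    [/\ forall m n, q (m + n) = q m + q n, forall a m, q (a *: m) = a *: q m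
      & forall m, q m = 0 <-> J m].
Proof.
move=> J0 JB JZ; pose P : {pred M} := fun m => `[< J m >].
have inP m : m \in P = `[< J m >] by [].
have Pz : zmod_closed P.
  split=> [|m n]; first exact/asboolP.
  by rewrite !inP !asboolE => Jm Jn; exact: JB.
pose PJ : zmodClosed M := HB.pack P (GRing.isZmodClosed.Build M P Pz).
have PZ a m : m \in PJ -> a *: m \in PJ.
  by rewrite !inP !asboolE => Jm; exact: JZ.
exists (module_quotient PZ), (@quotient_proj _ _ _ PZ); split.
- exact: quotient_projD.
- by move=> a m; rewrite -quotient_scaleE.
- by move=> m; rewrite quotient_proj_eq0 inP asboolE.
Qed.

(** Nakayama's lemma in a ring where only the elements of [I] commute with each other. The
    generators [d i] are eliminated one at a time, the last first, instead of taking a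
    determinant. *)
Lemma nakayama_annihilator (R : pzRingType) (I : R -> Prop) (n : nat)
    (d : nat -> R) : I 0 -> (forall x y, I x -> I y -> I (x + y)) ->
    (forall x, I x -> I (- x)) -> (forall x y, I x -> I y -> I (x * y)) ->
    (forall x y, I x -> I y -> x * y = y * x) ->
    (forall i, (i < n)%N -> exists t : nat -> R,
        (forall j, I (t j)) /\ d i = \sum_(j < n) t j * d j) ->
  exists2 x, I x & forall i, (i < n)%N -> (1 - x) * d i = 0.
Proof.
move=> I0 ID IN IM IC Id.
have IB x y : I x -> I y -> I (x - y) by move=> ? ?; apply: ID => //; apply: IN.
(* Invariant: after multiplication by [1 - x], every generator is a combination of the first [m]
   ones. *)
suff {Id} elim m : (m <= n)%N -> forall x, I x ->
    (forall i, (i < n)%N -> exists t : nat -> R,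
      (forall j, I (t j)) /\ (1 - x) * d i = \sum_(j < m) t j * d j) ->
    exists2 x, I x & forall i, (i < n)%N -> (1 - x) * d i = 0.
  apply: (elim n (leqnn n) 0 I0) => i /Id[t [It e]].
  by exists t; rewrite subr0 mul1r.
elim: m => [_|m IHm lt_mn] x Ix H.
  by exists x => // i /H[t [_ ->]]; rewrite big_ord0.
have [t [It tE]] := H m lt_mn.
(* Moving the term [t m * d m] to the left expresses [(1 - y) * d m] by the earlier generators. *)
pose y := x + t m; have Iy : I y by apply: ID.
have ydm : (1 - y) * d m = \sum_(j < m) t j * d j.
  move: tE; rewrite big_ord_recr /= => tE; apply: (addIr (t m * d m)).
  by rewrite -tE -mulrDl /y opprD addrA subrK.
clearbody y.
(* The new element is chosen so that [1 - (x + y - y * x) = (1 - y) * (1 - x)]. *)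
apply: (IHm (ltnW lt_mn) (x + y - y * x)) => [|i /H[s [Is sE]]].
  by apply: IB; [exact: ID | exact: IM].
exists (fun j => s j - y * s j + s m * t j); split.
  by move=> j; apply: ID; [apply: IB => //; apply: IM | apply: IM].
have -> : 1 - (x + y - y * x) = (1 - y) * (1 - x).
  rewrite mulrBr mulr1 mulrBl mul1r !opprD !opprK -!addrA; congr (1 + _).
  by rewrite addrCA.
rewrite -mulrA sE big_ord_recr /= mulrDr mulr_sumr.
have comm : (1 - y) * (s m * d m) = s m * ((1 - y) * d m).
  by rewrite !mulrA mulrBl mulrBr mul1r mulr1 (IC y).
rewrite comm ydm mulr_sumr -big_split /=; apply: eq_bigr => j _.
by rewrite !mulrDl !mulNr !mulrA mul1r.
Qed.

(* [tensor_image X v] says that [X] is the image of some [sum_i x_i (x) y_i] in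
   B (x)_A M_r(A) = M_r(B), and [v] its image under multiplication. *)
Section SeparabilityIdempotent.
Variables (A B : comPzRingType) (phi : {rmorphism A -> B}) (r : nat).
Variable R : B -> 'M[B]_r.
Hypothesis RD : forall x y, R (x + y) = R x + R y.
Hypothesis R1 : R 1 = 1.
Hypothesis RM : forall x y, R (x * y) = R x * R y.
Hypothesis Rphi : forall a, R (phi a) = (phi a)%:M.

Definition tensor_image (X : 'M[B]_r) (v : B) : Prop :=
  exists s : seq (B * B),
    X = \sum_(p <- s) p.1 *: R p.2 /\ v = \sum_(p <- s) p.1 * p.2.

Lemma tensor_image0 : tensor_image 0 0.
Proof. by exists [::]; rewrite !big_nil. Qed.

Lemma tensor_imageD X Y v w :
  tensor_image X v -> tensor_image Y w -> tensor_image (X + Y) (v + w).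
Proof.
by move=> [s [-> ->]] [t [-> ->]]; exists (s ++ t); rewrite !big_cat.
Qed.

Lemma tensor_imageZ c X v : tensor_image X v -> tensor_image (c *: X) (c * v).
Proof.
move=> [s [-> ->]]; exists [seq (c * p.1, p.2) | p <- s].
rewrite !big_map scaler_sumr mulr_sumr.
by split; apply: eq_bigr => p _; rewrite ?scalerA ?mulrA.
Qed.

Lemma tensor_imageN X v : tensor_image X v -> tensor_image (- X) (- v).
Proof. by move=> /(tensor_imageZ (-1)); rewrite scaleN1r mulN1r. Qed.

Lemma tensor_imageM X Y v w :
  tensor_image X v -> tensor_image Y w -> tensor_image (X * Y) (v * w).
Proof.
move=> [s [-> ->]] [t [-> ->]].
exists [seq (p.1 * q.1, p.2 * q.2) | p <- s, q <- t].
rewrite !big_allpairs_dep /= !mulr_suml; split; apply: eq_bigr => p _;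
  rewrite mulr_sumr; apply: eq_bigr => q _ /=; last by rewrite mulrACA.
by rewrite -mulmxE -scalemxAl -scalemxAr scalerA RM.
Qed.

Lemma tensor_imageC X Y v w :
  tensor_image X v -> tensor_image Y w -> X * Y = Y * X.
Proof.
move=> [s [-> _]] [t [-> _]]; rewrite !mulr_suml.
under eq_bigr do rewrite mulr_sumr.
under [RHS]eq_bigr do rewrite mulr_sumr.
rewrite exchange_big; apply: eq_bigr => q _; apply: eq_bigr => p _.
rewrite -!mulmxE -!scalemxAl -!scalemxAr !scalerA !mulmxE -!RM.
by rewrite mulrC [_.2 * _]mulrC.
Qed.

Lemma tensor_image_pure x y : tensor_image (x *: R y) (x * y).
Proof. by exists [:: (x, y)]; rewrite !big_seq1. Qed.

(** The image of b (x) 1 - 1 (x) b, which lies in the ideal of the diagonal. *)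
Definition diagonal_diff (b : B) : 'M[B]_r := b%:M - R b.

Lemma diagonal_diff_kernel b : tensor_image (diagonal_diff b) 0.
Proof.
rewrite -(subrr b) /diagonal_diff; apply: tensor_imageD; last first.
  by apply: tensor_imageN; have := tensor_image_pure 1 b; rewrite scale1r mul1r.
by have := tensor_image_pure b 1; rewrite R1 mulr1 scalemx1.
Qed.

(** The Leibniz rule up to a product of two elements of the diagonal ideal: modulo its square,
    [diagonal_diff] is a derivation. *)
Lemma diagonal_diffM a b : diagonal_diff (a * b) =
  a *: diagonal_diff b + b *: diagonal_diff a -
    diagonal_diff a * diagonal_diff b.
Proof.
rewrite /diagonal_diff RM mulrBl !mulrBr -!mulmxE -scalar_mxM !mul_scalar_mx.
rewrite mul_mx_scalar !scalerBr !scale_scalar_mx [b * a]mulrC.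
set u := (a * b)%:M; set v := a *: _; set w := b *: _; set z := _ *m _.
rewrite [- (_ - _ - _)]opprB [u - v + _]addrC -addrA [u - v + _]addrC subrK.
by rewrite addrA subrK.
Qed.

Lemma separability_idempotent (n : nat) (a : 'I_n -> B) :
    (forall b, exists c : 'I_n -> A, b = \sum_(i < n) phi (c i) * a i) ->
    zero_differentials phi ->
  exists2 e : 'M[B]_r, tensor_image e 1 & forall b, b *: e = R b * e.
Proof.
move=> gen unram; pose I X := tensor_image X 0.
(* [I] is the image of the diagonal ideal, the kernel of multiplication on B (x)_A B. *)
have I0 : I 0 by exact: tensor_image0.
have ID X Y : I X -> I Y -> I (X + Y).
  by move=> IX IY; have := tensor_imageD IX IY; rewrite addr0.
have IN X : I X -> I (- X) by move=> /tensor_imageN; rewrite oppr0.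
have IZ c X : I X -> I (c *: X) by move=> /(tensor_imageZ c); rewrite mulr0.
have IM X Y : I X -> I Y -> I (X * Y).
  by move=> IX IY; have := tensor_imageM IX IY; rewrite mulr0.
have IC X Y : I X -> I Y -> X * Y = Y * X by exact: tensor_imageC.
(* [J] is the square of [I]: the smallest additive subgroup containing all products of two elements
   of [I]. *)
pose J X := forall K : 'M[B]_r -> Prop, K 0 ->
  (forall Y Z, K Y -> K Z -> K (Y - Z)) ->
  (forall Y Z, I Y -> I Z -> K (Y * Z)) -> K X.
have JM X Y : I X -> I Y -> J (X * Y) by move=> IX IY K _ _; apply.
have J0 : J 0 by move=> K.
have JB X Y : J X -> J Y -> J (X - Y).
  by move=> JX JY K K0 KB KM; apply: (KB); [apply: JX | apply: JY].
have JZ c X : J X -> J (c *: X).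
  move=> JX; apply: (JX (fun Y => J (c *: Y))); first by rewrite scaler0.
    by move=> Y Z; rewrite scalerBr; apply: JB.
  by move=> Y Z IY IZ'; rewrite -mulmxE scalemxAl; apply: JM => //; apply: IZ.
have [Q [q [qD qZ q0]]] := exists_quotient_module J0 JB JZ.
have qB m m' : q (m - m') = q m - q m' by rewrite -scaleN1r qD qZ scaleN1r.
have RZ x b : R (phi x * b) = phi x *: R b.
  by rewrite RM Rphi -mulmxE mul_scalar_mx.
(* Followed by the projection modulo [J], [diagonal_diff] is an A-derivation, hence zero because B
   is unramified over A. *)
have dJ b : J (diagonal_diff b).
  apply/q0; move: b; apply: (unram Q (q \o diagonal_diff)) => [x y|x y|x] /=.
  - rewrite -qD; congr q; rewrite /diagonal_diff RD raddfD.
    by rewrite [RHS]addrACA -opprD.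
  - rewrite diagonal_diffM qB qD !qZ; set z := q (_ * _).
    have -> : z = 0 by apply/q0; apply: JM; apply: diagonal_diff_kernel.
    by rewrite subr0.
  - by rewrite /diagonal_diff Rphi subrr; apply/q0.
(* The generators of [I], extended by 0 to all naturals to fit [nakayama_annihilator]. *)
pose d i := if insub i is Some j then diagonal_diff (a j) else 0.
have dE (j : 'I_n) : d j = diagonal_diff (a j) by rewrite /d valK.
have dgen b : exists c : 'I_n -> B, diagonal_diff b = \sum_(i < n) c i *: d i.
  have [c bE] := gen b; exists (fun i => phi (c i)).
  under eq_bigr do rewrite dE scalerBr -RZ scale_scalar_mx.
  rewrite sumrB /diagonal_diff {1}bE raddf_sum; congr (_ - _).
  rewrite {1}bE; elim/big_ind2: _ => [|x1 X x2 Y <- <-|//]; last exact: RD.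
  by apply: (addrI (R 0)); rewrite -RD !addr0.
have Igen X : I X -> exists c : 'I_n -> B, X = \sum_(i < n) c i *: d i.
  move=> [s [XE sE]].
  (* The extra terms add up to the scalar matrix of the sum of the [p.1 * p.2], which is 0. *)
  have -> : X = \sum_(p <- s) (- p.1) *: diagonal_diff p.2.
    under eq_bigr do rewrite scalerBr !scaleNr opprK scale_scalar_mx.
    rewrite big_split /= -XE sumrN -(raddf_sum (@scalar_mx B r)) -sE.
    by rewrite raddf0 oppr0 add0r.
  elim: s {XE sE} => [|p s [c IHs]].
    by exists (fun=> 0); rewrite big_nil big1 // => i _; rewrite scale0r.
  have [c' E] := dgen p.2; exists (fun i => - p.1 * c' i + c i).
  rewrite big_cons IHs E scaler_sumr -big_split /=.
  by apply: eq_bigr => i _; rewrite scalerDl scalerA.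
pose span X := exists t : nat -> 'M[B]_r,
  (forall j, I (t j)) /\ X = \sum_(j < n) t j * d j.
have Jgen X : J X -> span X.
  move=> /(_ span); apply.
  - by exists (fun=> 0); split=> //; rewrite big1 // => j _; rewrite mul0r.
  - move=> U V [t [It ->]] [u [Iu ->]]; exists (fun j => t j - u j); split.
      by move=> j; apply: ID => //; apply: IN.
    by rewrite -sumrB; apply: eq_bigr => j _; rewrite mulrBl.
  move=> U V IU /Igen[c ->].
  exists (fun j => if insub j is Some k then c k *: U else 0); split.
    by move=> j; case: insub => [k|//]; apply: IZ.
  rewrite mulr_sumr; apply: eq_bigr => j _.
  by rewrite valK -!mulmxE -scalemxAl scalemxAr.
have [i lt_in|X IX Xd] := nakayama_annihilator (d := d) I0 ID IN IM IC (n := n).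
  by apply: Jgen; rewrite -[d i]/(d (Ordinal lt_in)) dE.
have T1X : tensor_image (1 - X) (1 - 0).
  apply: tensor_imageD; last exact: tensor_imageN.
  by have := tensor_image_pure 1 1; rewrite R1 scale1r mulr1.
rewrite subr0 in T1X; exists (1 - X) => //.
move=> b; apply/eqP; rewrite -subr_eq0; apply/eqP.
(* The idempotent is [1 - X]. Tensor images commute, and [1 - X] kills every [d i], hence every
   [diagonal_diff b]. *)
have -> : b *: (1 - X) - R b * (1 - X) = diagonal_diff b * (1 - X).
  by rewrite /diagonal_diff mulrBl -!mulmxE mul_scalar_mx.
rewrite (tensor_imageC (diagonal_diff_kernel b) T1X).
have [c ->] := dgen b; rewrite mulr_sumr big1 // => i _.
by rewrite -mulmxE -scalemxAr mulmxE Xd ?scaler0.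
Qed.

End SeparabilityIdempotent.

End Algebra.

(** * Sections over affine and integral schemes *)

Section RingedSpaces.
Local Open Scope ring_scope.
Local Open Scope classical_set_scope.

Lemma opens_eq (X : topologicalType) (U V : opens X) :
  oset U = oset V -> U = V.
Proof.
case: U V => [U oU] [V oV] /= UV; case: _ / UV in oV *.
by congr Opens; exact: Prop_irrelevance.
Qed.

Definition opensI (X : topologicalType) (U V : opens X) : opens X :=
  Opens (openI (oset_open U) (oset_open V)).

Definition opensU (X : topologicalType) (U V : opens X) : opens X :=
  Opens (openU (oset_open U) (oset_open V)).

Lemma res_id (X : ringed_space) (U : opens X) (h : U `<=` U) s : res h s = s.
Proof. by have [[/(_ U h s)]] := res_sheaf X. Qed.

Lemma res_res (X : ringed_space) (U V W : opens X) (hUV : V `<=` U)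
    (hVW : W `<=` V) (hUW : W `<=` U) s : res hVW (res hUV s) = res hUW s.
Proof. by have [[_ /(_ U V W hUV hVW hUW s)]] := res_sheaf X. Qed.

Lemma res_irrelevance (X : ringed_space) (U V : opens X) (h h' : V `<=` U) s :
  res h s = res h' s.
Proof. by rewrite (Prop_irrelevance h h'). Qed.

Lemma sec_eq_local (X : ringed_space) (U : opens X) (s t : sec X U) :
    (forall x, oset U x ->
       exists (V : opens X) (h : V `<=` U), oset V x /\ res h s = res h t) ->
  s = t.
Proof.
move=> loc; pose I := {V : opens X & {h : V `<=` U | res h s = res h t}}.
have [_ /(_ I U (fun i => projT1 i) (fun i => proj1_sig (projT2 i)))] :=
  res_sheaf X.
case=> [x /loc[V [h [Vx E]]]|sep _]; last by apply: sep => -[V [h E]].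
by exists (existT _ V (exist _ h E)).
Qed.

Lemma sec_eq0 (X : ringed_space) (U : opens X) (s t : sec X U) :
  ~ (U !=set0) -> s = t.
Proof.
by move=> U0; apply: sec_eq_local => x Ux; case: U0; exists x.
Qed.

Lemma is_unit_rmorph (R S : comPzRingType) (f : {rmorphism R -> S}) a :
  is_unit a -> is_unit (f a).
Proof. by move=> [b ab]; exists (f b); rewrite -rmorphM ab rmorph1. Qed.

Lemma is_unitX (R : comPzRingType) (a : R) n : is_unit a -> is_unit (a ^+ n).
Proof. by move=> [b ab]; exists (b ^+ n); rewrite -exprMn ab expr1n. Qed.

Lemma unit_mulI (R : comPzRingType) (a x y : R) :
  is_unit a -> a * x = a * y -> x = y.
Proof.
move=> [b ab] axy; rewrite -[x]mul1r -[y]mul1r -ab [a * b]mulrC -!mulrA.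
by rewrite axy.
Qed.

Lemma prime_idealX (R : comPzRingType) (P : set R) a n :
  prime_ideal P -> P (a ^+ n) -> P a.
Proof.
move=> [_ _ _ P1 PM]; elim: n => [|n IHn]; first by rewrite expr0.
by rewrite exprS => /PM[].
Qed.

(* The homeomorphism in [is_affine] is forced: it sends [x] to the functions
   vanishing at [x]. *)
Lemma affine_points (X : ringed_space) (U : opens X) :
  is_affine U ->
  let h x := [set f : sec X U | ~ unit_at f x] in
  [/\ forall x, oset U x -> prime_ideal (h x),
      forall x y, oset U x -> oset U y -> h x = h y -> x = y,
      forall P, prime_ideal P -> exists2 x, oset U x & h x = P,
      forall W : set X, W `<=` U ->
        (open W <-> exists T : set (sec X U),
           forall x, oset U x -> (W x <-> exists2 f, T f & ~ h x f))
    & forall (f : sec X U) (V : opens X) (hVU : V `<=` U),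
        (forall x, oset U x -> (oset V x <-> ~ h x f)) ->
        is_localization_away (res hVU) f].
Proof.
move=> [h [prm inj surj top loc]] h'.
have basic f : exists (V : opens X) (hVU : V `<=` U),
    (forall y, oset U y -> (oset V y <-> ~ h y f)) /\
    is_localization_away (res hVU) f.
  have hVU : [set y | oset U y /\ ~ h y f] `<=` U by move=> y [].
  have oV : open [set y | oset U y /\ ~ h y f].
    apply/(top _ hVU); exists [set f] => y Uy.
    by split=> [[_ nf]|[g -> nf]]; [exists f | split].
  have VE y : oset U y -> (oset (Opens oV) y <-> ~ h y f).
    by move=> Uy; split=> [[]|].
  by exists (Opens oV), hVU; split=> //; exact: (loc f (Opens oV) hVU VE).
have hE x : oset U x -> h x = h' x.
  move=> Ux; apply/seteqP; split=> f; rewrite /h' /=; last first.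
    move=> nf; apply: contrapT => hf; apply: nf.
    have [V [hVU [VE [fV _ _]]]] := basic f.
    by exists V, hVU; split=> //; apply/VE.
  move=> hf [V [hVU [Vx [b fb]]]].
  (* Some D(g) containing [x] lies in [V], and there the inverse of [f] is a / g^n. So a power of
     [g] is a multiple of [f], and [g] would lie in the prime [h x]. *)
  have [_ _ hM _ _] := prm x Ux.
  have [T TP] := (top _ hVU).1 (oset_open V).
  have [g Tg ng] := (TP x Ux).1 Vx.
  have [W [hWU [WE [gW Wsurj Winj]]]] := basic g.
  have hWV : W `<=` V.
    move=> y Wy; have Uy : oset U y by exact: (hWU y Wy).
    by apply/(TP y Uy); exists g => //; apply/(WE y Uy).
  have [a [n an]] := Wsurj (res hWV b).
  have /Winj[m gm0] : res hWU (g ^+ n - f * a) = 0.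
    rewrite rmorphB rmorphM -an mulrA -(res_res hVU hWV hWU f) -rmorphM fb.
    by rewrite rmorph1 mul1r rmorphXn subrr.
  apply: ng; apply: (@prime_idealX _ _ _ (m + n) (prm x Ux)); rewrite exprD.
  have -> : g ^+ m * g ^+ n = (g ^+ m * a) * f.
    by apply/eqP; rewrite -mulrA [a * f]mulrC -subr_eq0 -mulrBr gm0.
  exact: hM.
split.
- by move=> x Ux; rewrite -hE //; exact: prm.
- by move=> x y Ux Uy; rewrite -!hE //; exact: inj.
- by move=> P /surj[x Ux xP]; exists x; rewrite -?hE.
- move=> W hW; apply: (iff_trans (top W hW)); split=> -[T TP]; exists T => x Ux.
    by rewrite -hE //; exact: TP.
  by rewrite hE //; exact: TP.
- by move=> f V hVU VE; apply: loc => x Ux; rewrite hE //; exact: VE.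
Qed.

Lemma affine_localization (X : ringed_space) (U V : opens X) (h : V `<=` U) f :
  is_affine U -> (forall x, oset U x -> (oset V x <-> unit_at f x)) ->
  is_localization_away (res h) f.
Proof.
move=> /affine_points[_ _ _ _ loc] VE; apply: loc => x Ux.
by apply: (iff_trans (VE x Ux)); split=> [? //|]; exact: contrapT.
Qed.

Lemma affine_basis (X : ringed_space) (U : opens X) (W : set X) x :
  is_affine U -> oset U x -> open W -> W x ->
  exists (V : opens X) (h : V `<=` U) (f : sec X U),
    [/\ oset V x, V `<=` W, is_localization_away (res h) f
      & forall y, oset U y -> (oset V y <-> unit_at f y)].
Proof.
move=> Uaff Ux oW Wx; have [_ _ _ top _] := affine_points Uaff.
have hWU : W `&` U `<=` U by move=> y [].
have [T TP] := (top _ hWU).1 (openI oW (oset_open U)).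
have [f Tf /contrapT fx] := (TP x Ux).1 (conj Wx Ux).
have hVU : [set y | oset U y /\ unit_at f y] `<=` U by move=> y [].
have oV : open [set y | oset U y /\ unit_at f y].
  apply/(top _ hVU); exists [set f] => y Uy.
  by split=> [[_ uf]|[g -> /contrapT uf]]; [exists f => //; apply | split].
have VE y : oset U y -> (oset (Opens oV) y <-> unit_at f y).
  by move=> Uy; split=> [[]|].
exists (Opens oV), hVU, f; split=> //.
- move=> y [Uy uf]; have [] : (W `&` U) y; last by [].
  by apply/TP => //; exists f => //; apply.
- exact: affine_localization.
Qed.

(** If the two sets were disjoint, 1 on [U] and 0 on [V] would glue to a nontrivial idempotent over
    the union. *)
Lemma integral_meet (X : ringed_space) (U V : opens X) : integral X ->
  U !=set0 -> V !=set0 -> U `&` V !=set0.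
Proof.
move=> [_ int] U0 V0; apply: contrapT => UV0.
pose W := opensU U V.
have hU : U `<=` W by left.
have hV : V `<=` W by right.
pose F (b : bool) := if b then U else V.
have hF b : F b `<=` W by case: b.
pose s b : sec X (F b) := b%:R.
have [_ /(_ bool W F hF)[]] := res_sheaf X.
  by move=> x [Ux|Vx]; [exists true | exists false].
move=> sep /(_ s)[|a aE].
  move=> b c Z hb hc; have [Z0|Z0] := pselect (Z !=set0); last exact: sec_eq0.
  case: b c hb hc => [] [] hb hc; do ?exact: res_irrelevance.
    by case: UV0; have [x Zx] := Z0; exists x; split; [exact: hb | exact: hc].
  by case: UV0; have [x Zx] := Z0; exists x; split; [exact: hc | exact: hb].
have [x Ux] := U0; have W0 : W !=set0 by exists x; left.
have [_ /(_ a (1 - a))[]] := int W W0.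
- apply: sep => -[]; rewrite rmorphM rmorphB rmorph1 rmorph0 aE.
    by rewrite subrr mulr0.
  by rewrite mul0r.
- move=> a0; have [/= + _] := int U U0; apply.
  by have := aE true; rewrite a0 rmorph0.
- move=> /eqP; rewrite subr_eq0 => /eqP a1; have [/= + _] := int V V0; apply.
  by have := aE false; rewrite -a1 rmorph1.
Qed.

(** Locally [s] is a fraction a / f^n on an affine chart. Irreducibility gives a nonempty D(g)
    inside [W] on which [a] vanishes, so g^m a = 0 in a domain with g nonzero, and a = 0. *)
Lemma res_inj (X : ringed_space) (V W : opens X) (h : W `<=` V) s :
  integral X -> is_scheme X -> W !=set0 -> res h s = 0 -> s = 0.
Proof.
move=> int sch W0 sW0; apply: sec_eq_local => x Vx.
have [U Ux Uaff] := sch x.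
have [D [hDU [f [Dx hDV [fD Dsurj _] _]]]] :=
  affine_basis Uaff Ux (oset_open V) Vx.
exists D, hDV; split=> //; rewrite rmorph0.
have D0 : D !=set0 by exists x.
have [y [Dy Wy]] := integral_meet int D0 W0.
have [E [hEU [g [Ey hEDW [gE _ Einj] _]]]] :=
  affine_basis Uaff (hDU _ Dy) (openI (oset_open D) (oset_open W)) (conj Dy Wy).
have hED : E `<=` D by move=> z /hEDW[].
have hEW : E `<=` W by move=> z /hEDW[].
have hEV : E `<=` V by move=> z /hEW /h.
have [a [n aE]] := Dsurj (res hDV s).
have E0 : E !=set0 by exists y.
have U0 : U !=set0 by exists x.
have [n10 dom] := int.2 U U0.
have /Einj[m] : res hEU a = 0.
  rewrite -(res_res hDU hED) -aE rmorphM (res_res _ _ hEV).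
  by rewrite -(res_res h hEW) sW0 rmorph0 mul0r.
have g0 : g <> 0.
  move=> g0; have [b] := gE; rewrite g0 rmorph0 mul0r => /esym.
  exact: (int.2 E E0).1.
have gm0 : g ^+ m <> 0.
  elim: m => [|m IHm]; first by rewrite expr0.
  by rewrite exprS => /dom[].
move=> /dom[//|a0]; apply: (unit_mulI (is_unitX n fD)).
by rewrite mulrC aE a0 rmorph0 mulr0.
Qed.

Lemma res_inj_eq (X : ringed_space) (V W : opens X) (h : W `<=` V) s t :
  integral X -> is_scheme X -> W !=set0 -> res h s = res h t -> s = t.
Proof.
move=> int sch W0 st; apply/eqP; rewrite -subr_eq0; apply/eqP.
by apply: (res_inj (h := h)) => //; rewrite rmorphB st subrr.
Qed.

End RingedSpaces.

(** * Global sections of a projective variety *)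

Section GlobalSections.
Local Open Scope ring_scope.
Local Open Scope classical_set_scope.

(** The [m j] span a finite-dimensional space stable under [f]. Cayley-Hamilton makes a product of
    factors [f - c z] kill a nonzero element of the domain [A], so one factor vanishes. *)
Lemma scalar_of_invariant_tuple (k : closedFieldType) (A : comPzRingType)
    (c : {rmorphism k -> A}) (n : nat) (m : 'I_n.+1 -> A) (f : A) :
    (forall a b : A, a * b = 0 -> a = 0 \/ b = 0) ->
    (forall j, exists l : 'I_n.+1 -> k, f * m j = \sum_i c (l i) * m i) ->
    (exists j, m j <> 0) ->
  exists z, f = c z.
Proof.
move=> dom /choice[l fm] [j0 mj0].
pose C : 'M[k]_n.+1 := \matrix_(i, j) l i j.
(* [mu] sends coordinates to the element they represent; it carries right multiplication by [C] to
   multiplication by [f]. *)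
pose mu (v : 'rV[k]_n.+1) := \sum_i c (v 0 i) * m i.
have muC v : mu (v *m C) = f * mu v.
  rewrite mulr_sumr; under [RHS]eq_bigr => i _ do
    rewrite mulrCA fm mulr_sumr.
  rewrite exchange_big; apply: eq_bigr => i _ /=.
  rewrite mxE rmorph_sum mulr_suml; apply: eq_bigr => j _.
  by rewrite mxE rmorphM mulrA.
have muB v w : mu (v - w) = mu v - mu w.
  by rewrite -sumrB; apply: eq_bigr => i _; rewrite !mxE rmorphB mulrBl.
have muZ z v : mu (z *: v) = c z * mu v.
  by rewrite mulr_sumr; apply: eq_bigr => i _; rewrite mxE rmorphM mulrA.
have [s sE] := closed_field_poly_normal (char_poly C).
have := Cayley_Hamilton C.
rewrite sE (monicP (char_poly_monic C)) scale1r => hC.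
pose v : 'rV[k]_n.+1 := delta_mx 0 j0.
have muv : mu v = m j0.
  rewrite /mu (bigD1 j0) //= big1 => [|i ij].
    by rewrite mxE !eqxx rmorph1 mul1r addr0.
  by rewrite mxE eqxx (negbTE ij) rmorph0 mul0r.
have : (\prod_(z <- s) (f - c z)) * mu v = 0.
  have -> : 0 = mu (v *m horner_mx C (\prod_(z <- s) ('X - z%:P))).
    by rewrite hC mulmx0 /mu big1 // => i _; rewrite mxE rmorph0 mul0r.
  elim: s {sE hC muv} (v) => [|z s IHs] w.
    by rewrite !big_nil rmorph1 mul1r mulmx1.
  rewrite !big_cons rmorphM /= -mulmxE mulmxA -IHs rmorphB /= horner_mx_X.
  rewrite horner_mx_C mulmxBr mul_mx_scalar muB muC muZ -mulrBl.
  by rewrite [(f - c z) * \prod_(_ <- _) _]mulrC mulrA.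
rewrite muv => /dom[|//]; elim: s {sE hC} => [|z s IHs].
  (* An empty product would give 1 = 0 in [A], contradicting that [m j0] is nonzero. *)
  by rewrite big_nil => A0; case: mj0; rewrite -[m j0]mul1r A0 mul0r.
by rewrite big_cons => /dom[/eqP|//]; rewrite subr_eq0 => /eqP ->; exists z.
Qed.

Lemma scalar_of_invariant_family (k : closedFieldType) (A : comPzRingType)
    (c : {rmorphism k -> A}) (J : finType) (m : J -> A) (f : A) :
    (forall a b : A, a * b = 0 -> a = 0 \/ b = 0) ->
    (forall j, exists l : J -> k, f * m j = \sum_i c (l i) * m i) ->
    (exists j, m j <> 0) ->
  exists z, f = c z.
Proof.
move=> dom fm [j mj].
have J0 : #|J|.-1.+1 = #|J| by rewrite prednK //; apply/card_gt0P; exists j.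
pose g (i : 'I_#|J|.-1.+1) : J := enum_val (cast_ord J0 i).
have gK : cancel g (fun j => cast_ord (esym J0) (enum_rank j)).
  by move=> i; rewrite /g enum_valK cast_ordK.
have Kg : cancel (fun j => cast_ord (esym J0) (enum_rank j)) g.
  by move=> i; rewrite /g cast_ordKV enum_rankK.
apply: (@scalar_of_invariant_tuple _ _ c _ (m \o g)) => // [i|].
  have [l ->] := fm (g i); exists (l \o g).
  rewrite (reindex g) //; apply: onW_bij.
  by exists (fun j => cast_ord (esym J0) (enum_rank j)).
by exists (cast_ord (esym J0) (enum_rank j)); rewrite /= Kg.
Qed.

Lemma unit_at_pull (k : fieldType) (X Y : kscheme k) (f : kmorphism X Y)
    (V : opens Y) (s : sec Y V) (x : X) : oset V (f x) ->
  unit_at (km_pull f V s) x <-> unit_at s (f x).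
Proof.
move=> Vx; split; first exact: km_local.
move=> [W [hWV [Wx sW]]].
have h : pre f W `<=` pre f V by move=> y; apply: hWV.
by exists (pre f W), h; split=> //; rewrite km_natural; exact: is_unit_rmorph.
Qed.

(** Here D(f) is empty, so the localization at [f] is the zero ring and a power of [f] vanishes. *)
Lemma nowhere_unit_eq0 (X : ringed_space) (U : opens X) (f : sec X U) :
  integral X -> is_affine U -> U !=set0 ->
  (forall x, oset U x -> ~ unit_at f x) -> f = 0.
Proof.
move=> int Uaff U0 nf; pose V : opens X := Opens (@open0 X).
have hVU : V `<=` U by [].
have [] := @affine_localization _ _ _ hVU f Uaff.
  by move=> x Ux; split=> // fx; case: (nf x).
move=> _ _ /(_ 1)[|n]; first by apply: sec_eq0 => -[].
rewrite mulr1; have [n10 dom] := int.2 U U0.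
by elim: n => [|n IHn]; rewrite ?expr0 // exprS => /dom[].
Qed.

Lemma kconst_res (k : fieldType) (X : kscheme k) (U V : opens X)
    (h : V `<=` U) c : res h (kconst U c) = kconst V c.
Proof. exact: res_res. Qed.

End GlobalSections.

Section ProjectiveSections.
Local Open Scope ring_scope.
Local Open Scope classical_set_scope.

(** * Homogeneous forms evaluated in a ring of sections *)

Section Monomials.
Variables (k : fieldType) (A : comPzRingType) (c : {rmorphism k -> A}).
Variables (n : nat) (x : 'I_n.+1 -> A).

Definition mon (e : 'I_n.+1 -> nat) : A := \prod_i x i ^+ e i.

Lemma monD e e' : mon (fun i => (e i + e' i)%N) = mon e * mon e'.
Proof. by rewrite -big_split; apply: eq_bigr => i _; rewrite exprD. Qed.

(** Bounded exponents give a finite index type; those whose total degree is not [N] are sent to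
    0. *)
Definition hmon N (e : {ffun 'I_n.+1 -> 'I_N.+1}) : A :=
  if (\sum_i e i)%N == N then mon (fun i => e i) else 0.

Definition hspan N (a : A) : Prop :=
  exists l : {ffun 'I_n.+1 -> 'I_N.+1} -> k, a = \sum_e c (l e) * hmon e.

Lemma hspan0 N : hspan N 0.
Proof.
by exists (fun=> 0); rewrite big1 // => e _; rewrite rmorph0 mul0r.
Qed.

Lemma hspanD N a b : hspan N a -> hspan N b -> hspan N (a + b).
Proof.
move=> [l ->] [m ->]; exists (fun e => l e + m e); rewrite -big_split.
by apply: eq_bigr => e _; rewrite rmorphD mulrDl.
Qed.

Lemma hspanZ N z a : hspan N a -> hspan N (c z * a).
Proof.
move=> [l ->]; exists (fun e => z * l e); rewrite mulr_sumr.
by apply: eq_bigr => e _; rewrite rmorphM mulrA.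
Qed.

Lemma hspan_mon N e : (\sum_i e i)%N = N -> hspan N (mon e).
Proof.
move=> eN; have eb i : (e i < N.+1)%N.
  by rewrite ltnS -eN (bigD1 i) //= leq_addr.
pose e' : {ffun 'I_n.+1 -> 'I_N.+1} := [ffun i => Ordinal (eb i)].
exists (fun i => (i == e')%:R).
rewrite (bigD1 e') //= eqxx big1 => [|i /negbTE ->].
  rewrite rmorph1 mul1r addr0 /hmon.
  have -> : (\sum_i e' i)%N = N.
    by rewrite -[RHS]eN; apply: eq_bigr => i _; rewrite ffunE.
  by rewrite eqxx; apply: eq_bigr => i _; rewrite ffunE.
by rewrite rmorph0 mul0r.
Qed.

Lemma hspan_sum N (I : Type) (s : seq I) (F : I -> A) :
  (forall i, hspan N (F i)) -> hspan N (\sum_(i <- s) F i).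
Proof.
by move=> HF; elim/big_rec: _ => [|i a _]; [exact: hspan0 | exact: hspanD].
Qed.

End Monomials.

(** Homogenization: since [t l = 1], a polynomial in the other [t j] can be padded with powers of
    [t l] to any sufficiently large degree. *)
Lemma affine_chart_generation (k : fieldType) (A B : comPzRingType)
    (c : {rmorphism k -> A}) (cB : k -> B) (g : {rmorphism B -> A}) (n : nat)
    (t : 'I_n.+1 -> B) (l : 'I_n.+1) : (forall z, g (cB z) = c z) ->
    bijective (peval cB (fun j : 'I_n => t (lift l j))) ->
    (forall a, exists b, g b = a) -> t l = 1 ->
  forall a, exists M0 : nat, forall M, (M0 <= M)%N ->
    exists (I : Type) (s : seq I) (z : I -> k) (q : I -> 'I_n.+1 -> nat),
      (forall i, (\sum_j q i j)%N = M) /\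
      a = \sum_(i <- s) c (z i) * mon (fun j => g (t j)) (q i).
Proof.
move=> gc [r _ rK] gsurj tl a; have [b <-] := gsurj a.
rewrite -(rK b) /peval; set p := r b.
pose deg (m : multinom n) := (\sum_(j < n) fun_of_multinom m j)%N.
exists (\max_(m <- msupp p) deg m) => M leM.
(* The exponent at [l] fills the degree up to [M]. A monomial of degree above [M], absent from [p],
   gets a dummy vector of total [M]. *)
pose q (m : multinom n) (j : 'I_n.+1) : nat :=
  if (deg m <= M)%N then
    if unlift l j is Some i then fun_of_multinom m i else (M - deg m)%N
  else if j == l then M else 0%N.
exists (multinom n), (msupp p), (fun m => mcoeff m p), q; split=> [m|].
  rewrite (bigD1_ord l) //= /q unlift_none eqxx; case: leqP => [le_mM|_].
    by under eq_bigr do rewrite liftK; rewrite subnK.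
  by rewrite big1 ?addn0 // => i _; rewrite eq_sym (negbTE (neq_lift _ _)).
rewrite rmorph_sum; apply: eq_big_seq => m mp.
rewrite rmorphM gc; congr (_ * _).
have le_mM : (deg m <= M)%N by apply: leq_trans leM; apply: leq_bigmax_seq.
rewrite rmorph_prod /mon (bigD1_ord l) //= /q le_mM unlift_none tl rmorph1.
by rewrite expr1n mul1r; apply: eq_bigr => i _; rewrite liftK rmorphXn.
Qed.

Lemma exists_large_exponent (n M : nat) (e : 'I_n.+1 -> nat) :
  (\sum_i e i = n.+1 * M)%N -> exists l, (M <= e l)%N.
Proof.
move=> eM; apply/existsP; apply: contraT; rewrite negb_exists => /forallP lt_eM.
suff : (\sum_i e i < n.+1 * M)%N by rewrite eM ltnn.
rewrite -[X in (X * _)%N]card_ord -sum_nat_const.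
rewrite big_ord_recl [ltnRHS]big_ord_recl.
rewrite -addSn leq_add ?ltnNge //.
by apply: leq_sum => i _; rewrite ltnW // ltnNge.
Qed.

(** On each chart [l], [f] is a form of degree [M] over x_l^M. A monomial of degree (n + 1) M is
    divisible by some x_l^M, so its product with [f] is again a form of that degree. Everything is
    computed on a fixed chart [l0], with [T l0 j] for x_j / x_l0. *)
Lemma global_sections_constant (k : closedFieldType) (X : kscheme k) :
    integral X -> projective X ->
  forall f : sec X (oT X), exists z, f = ks_const X z.
Proof.
move=> int [n [P [i [[U [t [cov aff chart locus trans]]] imm]]]] f.
have sch : is_scheme X := @ks_scheme k X.
pose D l := pre i (U l).
have Daff l : is_affine (D l) by have [] := imm _ (aff l).
pose T l j : sec X (D l) := km_pull i (U l) (t l j).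
pose c (V : opens X) : {rmorphism k -> sec X V} :=
  res (@subsetT _ (V : set X) : V `<=` oT X) \o ks_const X.
have cE V z : c V z = kconst V z by [].
have fD l : D l `<=` oT X by [].
have /choice[M0 M0P] l : exists M0 : nat, forall M, (M0 <= M)%N ->
    exists (I : Type) (s : seq I) (z : I -> k) (q : I -> 'I_n.+1 -> nat),
      (forall i, (\sum_j q i j)%N = M) /\
      res (fD l) f = \sum_(i <- s) c (D l) (z i) * mon (T l) (q i).
  have [tl bij] := chart l; apply: affine_chart_generation bij _ tl _.
    by move=> z; rewrite km_const.
  by have [] := imm _ (aff l).
(* The successor makes [M] positive, so that x_l^M is zero whenever x_l vanishes on X. *)
pose M := (\max_l M0 l).+1.
have leM l : (M0 l <= M)%N by rewrite ltnW // ltnS; apply: leq_bigmax.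
pose N := (n.+1 * M)%N.
have [[x _] nz] := int; have [l0 Dx] := cov (i x).
have D0 : D l0 !=set0 by exists x.
have [n10 dom] := nz _ D0.
have step e : (\sum_j e j)%N = N ->
    hspan (c (D l0)) (T l0) N (res (fD l0) f * mon (T l0) e).
  move=> eN; have [l leMe] := exists_large_exponent eN.
  have [Dl|Dl] := pselect (D l !=set0); last first.
    (* If X misses the chart [l], then x_l / x_l0 is nowhere a unit. *)
    have Tl0 : T l0 l = 0.
      apply: nowhere_unit_eq0 (Daff l0) D0 _ => // y Dy uT.
      by case: Dl; exists y; apply/(locus l0 l) => //; apply/unit_at_pull.
    have -> : mon (T l0) e = 0.
      rewrite /mon (bigD1 l) //= Tl0 -(prednK (leq_trans _ leMe)) //.
      by rewrite exprS !mul0r.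
    by rewrite mulr0; exact: hspan0.
  have [I [s [z [q [qM fE]]]]] := M0P l M (leM l).
  (* x_l^M is removed from the monomial and replaced by the numerator of [f] on the chart [l]. *)
  pose e' j := if j == l then (e j - M)%N else e j.
  pose a := \sum_(i <- s)
    c (D l0) (z i) * mon (T l0) (fun j => (e' j + q i j)%N).
  have e'N : (\sum_j e' j + M = N)%N.
    rewrite -eN (bigD1 l) //= [in RHS](bigD1 l) //= /e' eqxx addnAC subnK //.
    by congr (_ + _)%N; apply: eq_bigr => j /negbTE ->.
  suff -> : res (fD l0) f * mon (T l0) e = a.
    apply: hspan_sum => j; apply: hspanZ; apply: hspan_mon.
    by rewrite big_split /= qM.
  pose V := opensI (U l0) (U l).
  have h0 : V `<=` U l0 by move=> y [].
  have hl : V `<=` U l by move=> y [].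
  have g0 : pre i V `<=` D l0 by move=> y [].
  have gl : pre i V `<=` D l by move=> y [].
  have V0 : pre i V !=set0 by apply: (@integral_meet X (D l0) (D l)).
  apply: (res_inj_eq (h := g0)) => //.
  (* The change of charts x_j / x_l0 = (x_j / x_l) (x_l / x_l0). *)
  have Tt j : res g0 (T l0 j) = res gl (T l j) * res g0 (T l0 l).
    by rewrite /T !km_natural -rmorphM -trans.
  have monres (W : opens X) (h : pre i V `<=` W) (y : 'I_n.+1 -> sec X W) d :
      res h (mon y d) = mon (fun j => res h (y j)) d.
    by rewrite /mon rmorph_prod; apply: eq_bigr => j _; rewrite rmorphXn.
  have fV : pre i V `<=` oT X by [].
  rewrite rmorphM (res_res (fD l0) g0 fV) -(res_res (fD l) gl fV) fE.
  rewrite !rmorph_sum mulr_suml.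
  apply: eq_bigr => j _; rewrite !rmorphM !cE !kconst_res -mulrA; congr (_ * _).
  rewrite !monres monD mulrC.
  have -> : mon (fun j => res g0 (T l0 j)) e =
      mon (fun j => res g0 (T l0 j)) e' * res g0 (T l0 l) ^+ M.
    rewrite /mon (bigD1 l) //= [in RHS](bigD1 l) //= /e' eqxx mulrAC -exprD.
    rewrite subnK //.
    by congr (_ * _); apply: eq_bigr => m /negbTE ->.
  (* Since [M] is the sum of the exponents [q j], one factor x_l / x_l0 goes to each x_m / x_l. *)
  rewrite -mulrA; congr (_ * _); rewrite -[M](qM j) expr_sum -big_split /=.
  by apply: eq_bigr => m _; rewrite -exprMn mulrC -Tt.
have [||z fz] := @scalar_of_invariant_family k _ (c (D l0)) _
    (hmon (T l0) (N := N)) (res (fD l0) f) dom.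
- move=> e; rewrite /hmon; case: eqP => [eN|_]; first exact: step.
  by rewrite mulr0; apply: hspan0.
(* The nonzero form is x_l0^N, equal to 1 on the chart [l0]. *)
- pose e : {ffun 'I_n.+1 -> 'I_N.+1} :=
    [ffun j => if j == l0 then ord_max else ord0].
  have eN : (\sum_j e j)%N = N.
    rewrite (bigD1 l0) //= ffunE eqxx big1 ?addn0 // => j /negbTE jl.
    by rewrite ffunE jl.
  exists e; rewrite /hmon eN eqxx /mon (bigD1 l0) //=.
  have -> : T l0 l0 = 1 by have [tl _] := chart l0; rewrite /T tl rmorph1.
  rewrite expr1n mul1r big1 // => j /negbTE jl.
  by rewrite ffunE jl expr0.
exists z; apply: (res_inj_eq (h := fD l0)) => //.
by rewrite fz; apply: res_irrelevance.
Qed.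

End ProjectiveSections.

(** * Coverings with a free pushforward *)

Section Representation.
Local Open Scope ring_scope.
Local Open Scope classical_set_scope.

(** Row [j] of [rho b] is the image of [b] times the j-th basis vector; matrices act on row vectors
    from the right. *)
Lemma module_representation (A B : comPzRingType) (phi : {rmorphism A -> B})
    (M : lmodType B) (r : nat) (theta : M -> 'rV[A]_r) : bijective theta ->
    (forall m n, theta (m + n) = theta m + theta n) ->
    (forall a m, theta (phi a *: m) = a *: theta m) ->
  exists rho : B -> 'M[A]_r, forall b m, theta (b *: m) = theta m *m rho b.
Proof.
move=> [inv thetaK invK] thetaD thetaZ.
have theta0 : theta 0 = 0 by rewrite -(scale0r 0) -(rmorph0 phi) thetaZ scale0r.
have theta_sum (F : 'I_r -> M) : theta (\sum_i F i) = \sum_i theta (F i).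
  by elim/big_rec2: _ => // i m v _ <-.
exists (fun b => \matrix_j theta (b *: inv (delta_mx 0 j))) => b m.
have -> : m = \sum_j phi (theta m 0 j) *: inv (delta_mx 0 j).
  apply: (can_inj thetaK); rewrite theta_sum {1}[theta m]row_sum_delta.
  by apply: eq_bigr => j _; rewrite thetaZ invK.
set v := theta m.
have -> : theta (\sum_j phi (v 0 j) *: inv (delta_mx 0 j)) = v.
  rewrite theta_sum [RHS]row_sum_delta.
  by apply: eq_bigr => j _; rewrite thetaZ invK.
rewrite scaler_sumr theta_sum mulmx_sum_row; apply: eq_bigr => j _.
by rewrite scalerA mulrC -scalerA thetaZ rowK.
Qed.

Lemma row_mulmx_inj (A : comPzRingType) (r : nat) (M N : 'M[A]_r) :
  (forall j, delta_mx 0 j *m M = delta_mx 0 j *m N :> 'rV_r) -> M = N.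
Proof. by move=> MN; apply/row_matrixP => j; rewrite !rowE. Qed.

Variables (k : fieldType) (X Y : kscheme k) (f : kmorphism X Y).

Lemma pushforward_representation (E : omodule X) (r : nat) :
    omod_iso (pushforward f E) (free_omodule Y r) ->
  exists rho : forall V, sec X (pre f V) -> 'M[sec Y V]_r,
  [/\ forall V b c, rho V (b + c) = rho V b + rho V c,
      forall V b c, rho V (b * c) = rho V b * rho V c,
      forall V a, rho V (km_pull f V a) = a%:M
    & forall (U V : opens Y) (h : V `<=` U) (h' : pre f V `<=` pre f U) b,
        map_mx (res h) (rho U b) = rho V (res h' b)].
Proof.
move=> [phi [phi_bij phi_res]].
pose theta V : msec E (pre f V) -> 'rV[sec Y V]_r := phi V (@subsetT _ _).
have thetaD V m n : theta V (m + n) = theta V m + theta V n by exact: linearD.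
have thetaZ V a m : theta V (km_pull f V a *: m) = a *: theta V m.
  exact: (linearZZ (phi V (@subsetT _ _)) a (m : msec (pushforward f E) V)).
have theta_bij V : bijective (theta V) := phi_bij V _.
have theta_res (U V : opens Y) (h : V `<=` U) (h' : pre f V `<=` pre f U) m :
    map_mx (res h) (theta U m) = theta V (mres h' m).
  have := phi_res U V (@subsetT _ _) (@subsetT _ _) h m.
  by rewrite /= (Prop_irrelevance (pre_subset h) h').
have rhoP V := cid (module_representation (theta_bij V) (thetaD V) (thetaZ V)).
pose rho V := projT1 (rhoP V).
have rhoE V b m : theta V (b *: m) = theta V m *m rho V b.
  exact: projT2 (rhoP V) b m.
have ext V (M N : 'M[sec Y V]_r) :
    (forall m, theta V m *m M = theta V m *m N) -> M = N.
  move=> MN; apply: row_mulmx_inj => j; have [inv _ invK] := theta_bij V.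
  by rewrite -(invK (delta_mx 0 j)).
exists rho; split.
- by move=> V b c; apply: ext => m; rewrite mulmxDr -!rhoE scalerDl thetaD.
(* The right action reverses products, which is harmless as sections commute. *)
- move=> V b c; apply: ext => m.
  by rewrite -mulmxE mulmxA -!rhoE scalerA mulrC.
- by move=> V a; apply: ext => m; rewrite -rhoE thetaZ mul_mx_scalar.
- move=> U V h h' b; apply: row_mulmx_inj => j.
  have [inv _ invK] := theta_bij U.
  (* Each basis vector over [V] is the restriction of one over [U], where naturality of [theta]
     applies. *)
  have -> : delta_mx 0 j = theta V (mres h' (inv (delta_mx 0 j))) :> 'rV_r.
    by rewrite -(theta_res _ _ h) invK map_delta_mx.
  by rewrite -rhoE -mresZ -!(theta_res _ _ h) -map_mxM -rhoE.
Qed.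

End Representation.

(** * Gluing separability idempotents and descending sections *)

Section Descent.
Local Open Scope ring_scope.
Local Open Scope classical_set_scope.

Variables (k : closedFieldType) (X Y : kscheme k) (f : kmorphism X Y) (r : nat).
Variable rho : forall V, sec X (pre f V) -> 'M[sec Y V]_r.
Hypothesis rhoD : forall V b c, @rho V (b + c) = rho b + rho c.
Hypothesis rhoM : forall V b c, @rho V (b * c) = rho b * rho c.
Hypothesis rho_pull : forall V a, rho (km_pull f V a) = a%:M.
Hypothesis rho_res : forall (U V : opens Y) (h : V `<=` U)
  (h' : pre f V `<=` pre f U) b, map_mx (res h) (rho b) = rho (res h' b).

(** Extension of scalars of [rho] to O_X, as required by [tensor_image]. *)
Definition Rho V (b : sec X (pre f V)) : 'M[sec X (pre f V)]_r :=
  map_mx (km_pull f V) (rho b).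

Lemma RhoD V b c : @Rho V (b + c) = Rho b + Rho c.
Proof. by rewrite /Rho rhoD raddfD. Qed.

Lemma RhoM V b c : @Rho V (b * c) = Rho b * Rho c.
Proof. by rewrite /Rho rhoM -!mulmxE map_mxM. Qed.

Lemma Rho_pull V a : Rho (km_pull f V a) = (km_pull f V a)%:M.
Proof. by rewrite /Rho rho_pull map_scalar_mx. Qed.

Lemma Rho1 V : @Rho V 1 = 1.
Proof. by rewrite -(rmorph1 (km_pull f V)) Rho_pull rmorph1. Qed.

Lemma Rho_res (U V : opens Y) (h : pre f V `<=` pre f U) b : V `<=` U ->
  map_mx (res h) (Rho b) = Rho (res h b).
Proof.
move=> hVU; rewrite /Rho -(rho_res hVU h); apply/matrixP => i j.
by rewrite !mxE km_natural.
Qed.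

Definition sep_idempotent V (e : 'M[sec X (pre f V)]_r) : Prop :=
  tensor_image (@Rho V) e 1 /\ forall b, b *: e = Rho b * e.
Arguments sep_idempotent : clear implicits.

(** Write e as the sum of the x R(y). If e = 0, applying [rho] to the entries e_ij, taking the
    entries (j, l) and summing over j gives the (i, l) entry of the sum of the rho(y) rho(x), which
    is rho(1) = 1. *)
Lemma sep_idempotent_neq0 (V : opens Y) e :
  (1 : sec Y V) <> 0 -> sep_idempotent V e -> (0 < r)%N ->
  exists i j, e i j <> 0.
Proof.
move=> n10 [[s [eE sE]] _] r0; apply: contrapT => e0; apply: n10.
have eij i j : e i j = 0 by apply: contrapT => eij; apply: e0; exists i, j.
have rho0 : @rho V 0 = 0.
  by apply: (addrI (rho 0)); rewrite -rhoD !addr0.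
have rho_sum (F : sec X (pre f V) * sec X (pre f V) -> _) :
    @rho V (\sum_(p <- s) F p) = \sum_(p <- s) rho (F p).
  by elim/big_rec2: _ => // p a b _ <-.
have : @rho V 1 = 0.
  rewrite sE rho_sum; apply/matrixP => i l; rewrite summxE.
  under eq_bigr do rewrite mulrC rhoM -mulmxE mxE.
  rewrite exchange_big /= mxE big1 // => j _.
  have /(congr1 (fun b => rho b j l)) := eij i j.
  rewrite eE summxE rho_sum rho0 summxE mxE => E0.
  rewrite -[RHS]E0; apply: eq_bigr => p _.
  by rewrite !mxE rhoM rho_pull -mulmxE mul_mx_scalar mxE.
rewrite -(rmorph1 (km_pull f V)) rho_pull.
by move=> /matrixP/(_ (Ordinal r0) (Ordinal r0)); rewrite !mxE eqxx.
Qed.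

Lemma tensor_image_res (U V : opens Y) (h : pre f V `<=` pre f U) e :
  V `<=` U -> tensor_image (@Rho U) e 1 ->
  tensor_image (@Rho V) (map_mx (res h) e) 1.
Proof.
move=> hVU [s [-> s1]]; exists [seq (res h p.1, res h p.2) | p <- s].
rewrite !big_map -(rmorph1 (res h)) s1 rmorph_sum raddf_sum; split.
  by apply: eq_bigr => p _; rewrite /= map_mxZ Rho_res.
by apply: eq_bigr => p _; rewrite /= rmorphM.
Qed.

Lemma map_mx_scale_comm (A : comPzRingType) (a : A) (M N : 'M[A]_r) :
  is_unit a -> a *: M = a *: N -> M = N.
Proof.
move=> ua /matrixP MN; apply/matrixP => i j; apply: (unit_mulI ua).
by have := MN i j; rewrite !mxE.
Qed.

(** Each term x R(y) of [e] acts on [e'] as the scalar x y, and these add up to 1. As tensor images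
    commute, this yields uniqueness. *)
Lemma sep_idempotent_mulr (V : opens Y) e e' :
  tensor_image (@Rho V) e 1 -> sep_idempotent V e' -> e * e' = e'.
Proof.
move=> [s [-> s1]] [_ e'P]; rewrite mulr_suml -[RHS]scale1r s1 scaler_suml.
by apply: eq_bigr => p _; rewrite -mulmxE -scalemxAl mulmxE -e'P scalerA.
Qed.

Hypothesis fin : finite_morphism f.

Lemma pre_localization (V W : opens Y) (hWV : W `<=` V)
    (h : pre f W `<=` pre f V) (g : sec Y V) : is_affine V ->
    (forall y, oset V y -> (oset W y <-> unit_at g y)) ->
  is_localization_away (res h) (km_pull f V g).
Proof.
move=> Vaff WE; apply: affine_localization; first by have [] := fin Vaff.
move=> x Vx; apply: (iff_trans (WE (f x) Vx)); apply: iff_sym.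
exact: unit_at_pull.
Qed.

(** A section over the preimage of [W] comes from that of [V] after multiplication by a power of
    [g], a unit there that can be cancelled. *)
Lemma sep_idempotent_res (V W : opens Y) (hWV : W `<=` V)
    (h : pre f W `<=` pre f V) (g : sec Y V) e : is_affine V ->
    (forall y, oset V y -> (oset W y <-> unit_at g y)) ->
  sep_idempotent V e -> sep_idempotent W (map_mx (res h) e).
Proof.
move=> Vaff WE [te eP]; split; first exact: tensor_image_res.
move=> b; have [ug surj _] := pre_localization hWV h Vaff WE.
have [b' [n bE]] := surj b; have un := is_unitX n ug.
apply: (map_mx_scale_comm un); rewrite scalerA mulrC bE -map_mxZ eP.
rewrite -mulmxE map_mxM Rho_res // -bE mulrC -!rmorphXn km_natural RhoM.
by rewrite Rho_pull -!mulmxE mul_scalar_mx scalemxAl.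
Qed.

Lemma sep_idempotent_agree (V V' : opens Y) e e' (W : opens X)
    (h : W `<=` pre f V) (h' : W `<=` pre f V') : is_affine V -> is_affine V' ->
    sep_idempotent V e -> sep_idempotent V' e' ->
  map_mx (res h) e = map_mx (res h') e'.
Proof.
move=> Vaff V'aff eP e'P; apply/matrixP => i j; rewrite !mxE.
apply: sec_eq_local => x Wx.
have [Z [hZ [g [Zx ZV' _ gE]]]] :=
  affine_basis Vaff (h x Wx) (oset_open V') (h' x Wx).
have [Z' [hZ' [g' [Z'x Z'V _ g'E]]]] :=
  affine_basis V'aff (h' x Wx) (oset_open V) (h x Wx).
(* [T] need not be principal in [V] or [V']: the two product relations are proved on [Z] and [Z'],
   then restricted to [T]. *)
pose T := opensI Z Z'.
have hTZ : T `<=` Z by move=> y [].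
have hTZ' : T `<=` Z' by move=> y [].
pose hZp := pre_subset (f := f) hZ; pose hZ'p := pre_subset (f := f) hZ'.
pose kZ := pre_subset (f := f) ZV'; pose kZ' := pre_subset (f := f) Z'V.
pose hT := pre_subset (f := f) hTZ; pose hT' := pre_subset (f := f) hTZ'.
have eZ := sep_idempotent_res hZ hZp Vaff gE eP.
have e'Z' := sep_idempotent_res hZ' hZ'p V'aff g'E e'P.
have E1 := sep_idempotent_mulr (tensor_image_res kZ ZV' e'P.1) eZ.
have E2 := sep_idempotent_mulr (tensor_image_res kZ' Z'V eP.1) e'Z'.
pose TV := subset_trans hTZ hZ; pose TV' := subset_trans hTZ' hZ'.
pose a := map_mx (res (pre_subset (f := f) TV)) e.
pose a' := map_mx (res (pre_subset (f := f) TV')) e'.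
have mm (P Q S : opens X) (u : Q `<=` P) (v : S `<=` Q) (w : S `<=` P)
    (m : 'M[sec X P]_r) : map_mx (res v) (map_mx (res u) m) = map_mx (res w) m.
  by apply/matrixP => p q; rewrite !mxE (res_res u v w).
have aa' : a = a'.
  have F1 : a' * a = a.
    have := congr1 (map_mx (res hT)) E1; rewrite -mulmxE map_mxM.
    by rewrite !(mm _ _ _ _ _ (pre_subset TV)) !(mm _ _ _ _ _ (pre_subset TV')).
  have F2 : a * a' = a'.
    have := congr1 (map_mx (res hT')) E2; rewrite -mulmxE map_mxM.
    by rewrite !(mm _ _ _ _ _ (pre_subset TV)) !(mm _ _ _ _ _ (pre_subset TV')).
  rewrite -F1 -[RHS]F2; apply: (tensor_imageC (@RhoM T)).
    exact: tensor_image_res e'P.1.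
  exact: tensor_image_res eP.1.
have hS : opensI W (pre f T) `<=` W by move=> y [].
have hS' : opensI W (pre f T) `<=` pre f T by move=> y [].
exists (opensI W (pre f T)), hS; split; first by split.
have hSV : opensI W (pre f T) `<=` pre f V by move=> y [/h].
have hSV' : opensI W (pre f T) `<=` pre f V' by move=> y [/h'].
rewrite (res_res h hS hSV) (res_res h' hS hSV').
have := congr1 (fun m : 'M_r => res hS' (m i j)) aa'; rewrite !mxE.
by rewrite (res_res _ hS' hSV) (res_res _ hS' hSV').
Qed.

Hypothesis et : etale f.

Lemma exists_sep_idempotent (V : opens Y) :
  is_affine V -> exists e, sep_idempotent V e.
Proof.
move=> Vaff; have [preVaff [n [a gen]]] := fin Vaff.
have hU : pre f V `<=` pre f V by [].
have [_ unram] := et hU Vaff preVaff.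
have [||e te eP] := separability_idempotent (@RhoD V) (@Rho1 V) (@RhoM V)
  (@Rho_pull V) (n := n) (a := a) => //.
  move=> M d dD dM d0; apply: (unram M d) => // c.
  by rewrite /= res_id d0.
by exists e.
Qed.

Hypothesis schY : is_scheme Y.
Hypothesis constX : forall s : sec X (oT X), exists z, s = ks_const X z.

Lemma exists_constant_sep_idempotent : exists z : 'M[k]_r,
  forall V, is_affine V -> sep_idempotent V (map_mx (kconst (pre f V)) z).
Proof.
(* Indexing by all pairs of an affine open and an idempotent avoids choosing one for each open. *)
pose I := {V : opens Y & {e | is_affine V /\ sep_idempotent V e}}.
pose P (i : I) := pre f (projT1 i).
pose e (i : I) : 'M[sec X (P i)]_r := proj1_sig (projT2 i).
have eaff (i : I) : is_affine (projT1 i) by have [] := proj2_sig (projT2 i).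
have eP (i : I) : sep_idempotent (projT1 i) (e i).
  by have [] := proj2_sig (projT2 i).
have hP i : P i `<=` oT X by [].
have [_ glue] := res_sheaf X.
have /choice[z zP] : forall p : 'I_r * 'I_r, exists z : k,
    forall i, res (hP i) (ks_const X z) = e i p.1 p.2.
  move=> p; have [|_ /(_ (fun i => e i p.1 p.2))[|t tP]] := glue I (oT X) P hP.
  - move=> x _; have [V Vx Vaff] := schY (f x).
    have [eV eVP] := exists_sep_idempotent Vaff.
    pose i : I := existT _ V (exist _ eV (conj Vaff eVP)).
    by exists i.
  - move=> i j W hi hj.
    have /matrixP/(_ p.1 p.2) :=
      sep_idempotent_agree hi hj (eaff i) (eaff j) (eP i) (eP j).
    by rewrite !mxE.
  have [z tE] := constX t; exists z => i; rewrite -tE; exact: tP.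
exists (\matrix_(i, j) z (i, j)) => V Vaff.
have [eV eVP] := exists_sep_idempotent Vaff.
pose i : I := existT _ V (exist _ eV (conj Vaff eVP)).
suff -> : map_mx (kconst (pre f V)) (\matrix_(i, j) z (i, j)) = eV by [].
apply/matrixP => p q; rewrite !mxE -(zP (p, q) i); exact: res_irrelevance.
Qed.

Hypothesis intX : integral X.
Hypothesis intY : integral Y.
Hypothesis r_gt0 : (0 < r)%N.

(** An entry on the diagonal of [rho (km_pull f V a)] recovers [a]; one exists since r > 0. *)
Lemma km_pull_inj V : injective (km_pull f V).
Proof.
move=> a b ab; have := rho_pull a; rewrite ab rho_pull.
by move=> /matrixP/(_ (Ordinal r_gt0) (Ordinal r_gt0)); rewrite !mxE eqxx.
Qed.

Lemma km_pull_surj V (b : sec X (pre f V)) : exists a, km_pull f V a = b.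
Proof.
have [z zP] := exists_constant_sep_idempotent.
have [[x _] _] := intX; have [V0 V0x V0aff] := schY (f x).
have [p [q zpq]] : exists p q, z p q <> 0.
  have n10 : (1 : sec Y V0) <> 0 by apply: (intY.2 V0 _).1; exists (f x).
  have [p [q]] := sep_idempotent_neq0 n10 (zP V0 V0aff) r_gt0.
  rewrite mxE => zpq; exists p, q => z0; apply: zpq.
  by rewrite z0 /kconst !rmorph0.
(* The relation is known on affine opens only; for an arbitrary [V] it is checked locally, on
   principal opens of affines lying in [V]. *)
have bz : b *: map_mx (kconst (pre f V)) z =
    Rho b * map_mx (kconst (pre f V)) z.
  apply/matrixP => i j; apply: sec_eq_local => y Vy.
  have [U Uy Uaff] := schY (f y).
  have [W [hWU [g [Wy hWV _ gE]]]] := affine_basis Uaff Uy (oset_open V) Vy.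
  have [_ /(_ (res (pre_subset (f := f) hWV) b))] :=
    sep_idempotent_res hWU (pre_subset (f := f) hWU) Uaff gE (zP U Uaff).
  have kE (Z Z' : opens X) (h : Z' `<=` Z) :
      map_mx (res h) (map_mx (kconst Z) z) = map_mx (kconst Z') z.
    by apply/matrixP => m l; rewrite !mxE kconst_res.
  rewrite kE -(kE _ _ (pre_subset (f := f) hWV)) -Rho_res // -map_mxZ -mulmxE.
  rewrite -map_mxM.
  move=> /matrixP/(_ i j) E; exists (pre f W), (pre_subset (f := f) hWV).
  by split=> //; move: E; rewrite mulmxE [LHS]mxE [RHS]mxE.
have := congr1 (fun m : 'M_r => m p q) bz; rewrite -mulmxE !mxE => bE.
(* Entry (p, q) of [bz], solved for [b]: the entry [z p q] is a nonzero constant, and all the others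
   on the right come from [Y]. *)
exists (kconst V (z p q)^-1 * \sum_l rho b p l * kconst V (z l q)).
rewrite rmorphM km_const rmorph_sum.
under eq_bigr do rewrite rmorphM km_const.
have -> : \sum_i km_pull f V (rho b p i) * kconst (pre f V) (z i q) =
    b * kconst (pre f V) (z p q).
  by rewrite bE; apply: eq_bigr => l _; rewrite !mxE.
rewrite mulrCA /kconst -!rmorphM mulVf ?rmorph1 ?mulr1 //.
exact/eqP.
Qed.

(** * From bijections on sections to an isomorphism of schemes *)

Lemma prime_ideal_image (A B : comPzRingType) (phi : {rmorphism A -> B})
    (P : set A) : injective phi -> (forall b, exists a, phi a = b) ->
  prime_ideal P -> prime_ideal (phi @` P).
Proof.
move=> inj surj [P0 PD PM P1 Pp]; split.
- by exists 0; rewrite ?rmorph0.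
- move=> _ _ [a Pa <-] [b Pb <-].
  by exists (a + b); [exact: PD | rewrite rmorphD].
- move=> b _ [a Pa <-]; have [c <-] := surj b.
  by exists (c * a); [exact: PM | rewrite rmorphM].
- by move=> [a Pa]; rewrite -(rmorph1 phi) => /inj a1; apply: P1; rewrite -a1.
- move=> a b; have [c <-] := surj a; have [d <-] := surj b.
  move=> [e Pe]; rewrite -rmorphM => /inj eE; rewrite eE in Pe.
  by have [] := Pp _ _ Pe => ?; [left; exists c | right; exists d].
Qed.

(** The prime of [y] in an affine [V] is carried by [km_pull] to a prime upstairs. Its point [x]
    maps to [y], since the same functions vanish at both. *)
Lemma km_fun_surj y : exists x, f x = y.
Proof.
have [V Vy Vaff] := schY y; have [prm inj _ _ _] := affine_points Vaff.
have [preaff _] := fin Vaff; have [_ _ surj _ _] := affine_points preaff.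
have [x Vx xE] :=
  surj _ (prime_ideal_image (@km_pull_inj V) (@km_pull_surj V) (prm y Vy)).
exists x; apply: inj => //; apply/seteqP; split=> a /= na.
  move=> ua; have : [set g | ~ unit_at g x] (km_pull f V a).
    by move=> /unit_at_pull -/(_ Vx).
  by rewrite xE => -[c /= nc /km_pull_inj cE]; rewrite cE in nc.
have : [set g | ~ unit_at g x] (km_pull f V a) by rewrite xE; exists a.
by move=> nx /(unit_at_pull a Vx).
Qed.

(** Functions separate the points of an affine preimage, and they all come from [Y]. *)
Lemma km_fun_inj : injective f.
Proof.
move=> x x' fxx'; have [V Vx Vaff] := schY (f x).
have Vx' := Vx; rewrite fxx' in Vx'.
have [preaff _] := fin Vaff; have [_ inj _ _ _] := affine_points preaff.
apply: inj => //; apply/seteqP; split=> b /=; have [a <-] := km_pull_surj b.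
  move=> nx /(unit_at_pull a Vx') ux.
  by apply/nx/(unit_at_pull a Vx); rewrite fxx'.
move=> nx /(unit_at_pull a Vx) ux.
by apply/nx/(unit_at_pull a Vx'); rewrite -fxx'.
Qed.

Lemma open_local (T : topologicalType) (S : set T) :
  (forall x, S x -> exists O : set T, [/\ open O, O x & O `<=` S]) -> open S.
Proof.
move=> loc; rewrite openE => x /loc[O [oO Ox OS]].
by rewrite /interior nbhsE; exists O.
Qed.

Lemma open_unit_at (Z : ringed_space) (V : opens Z) (s : sec Z V) :
  open [set x | oset V x /\ unit_at s x].
Proof.
apply: open_local => x [Vx [W [hWV [Wx us]]]]; exists W; split=> //.
- exact: oset_open.
- by move=> y Wy; split; [exact: (hWV y) | exists W, hWV].
Qed.

Lemma km_fun_open (W : set X) : open W -> open (f @` W).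
Proof.
move=> oW; apply: open_local => _ [x Wx <-].
have [V Vx Vaff] := schY (f x); have [preaff _] := fin Vaff.
have [Z [hZ [b [Zx ZW _ bE]]]] := affine_basis preaff Vx oW Wx.
(* The principal open D(b) maps onto D(a) when [b] is the pullback of [a]. *)
have [a aE] := km_pull_surj b.
exists [set y | oset V y /\ unit_at a y]; split; first exact: open_unit_at.
  by split=> //; apply/(unit_at_pull a Vx); rewrite aE; apply/bE.
move=> y [Vy ua]; have [x' x'y] := km_fun_surj y; rewrite -x'y in Vy ua *.
by exists x' => //; apply/ZW/bE => //; rewrite -aE; apply/unit_at_pull.
Qed.

Lemma trivial_covering_of_representation : trivial_covering f.
Proof.
(* There is a single sheet, all of [X]. *)
exists 1%N, (fun=> oT X); split.
- by exists ord0.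
- by move=> i j; rewrite !ord1.
move=> _; split.
- by move=> y; have [x fx] := km_fun_surj y; exists x.
- by move=> x x' _ _; exact: km_fun_inj.
- by move=> W _; apply: km_fun_open; exact: oset_open.
move=> V W hW WE; have WE' : W = pre f V by apply: opens_eq; rewrite WE setTI.
subst W; have bij : bijective (km_pull f V).
  pose g b := projT1 (cid (@km_pull_surj V b)).
  have gK b : km_pull f V (g b) = b by exact: projT2 (cid (@km_pull_surj V b)).
  by exists g => // a; apply: km_pull_inj.
by apply: (eq_bij bij) => s; rewrite res_id.
Qed.

End Descent.

Theorem lemma2p3 (k : closedFieldType) (hk : [pchar k]%R =i pred0)
    (C D : kscheme k)
    (hC : smooth_projective_curve C) (hD : smooth_projective_curve D)
    (pi : kmorphism C D)
    (hpi : etale_covering pi) (hnt : ~ trivial_covering pi) :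
  ~ exists E : omodule C, relatively_ulrich pi E.
Proof.
move=> [E [_ [r r_gt0 /pushforward_representation]]].
move=> [rho [rhoD rhoM rho_pull rho_res]].
have [intC projC _ _] := hC; have [intD _ _ _] := hD; have [fin et] := hpi.
apply: hnt.
apply: (trivial_covering_of_representation rhoD rhoM rho_pull rho_res) => //.
  exact: ks_scheme.
exact: global_sections_constant.
Qed.
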